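(* Assume bounded outcomes: $Y(k,x)\in[0,1]$ and $F(k,x)\in[0,1]$ almost surely for all $k,x$. Then, for any judge-only algorithm producing an output $\widehat{k}$ after any (possibly random) number of rounds, there exist two instances $\mathcal{I}$ and $\mathcal{I}'$ in the model class such that: (i) the distribution of all observed data under $\mathcal{I}$ and $\mathcal{I}'$ is identical, but (ii) the best arm differs. Consequently, for at least one instance, $\mathbb{P}(\widehat{k}\neq k^\star)\ge \tfrac12$.
   Context: Model. There are $K$ arms indexed by $k\in[K]=\{1,\dots,K\}$. Contexts $X\in\mathcal{X}$ are drawn from a distribution $\mathcal{D}$. For every arm $k$ and context $X=x$ there is a human audit outcome $Y(k,x)\in[0,1]$ (expensive, the true objective) and a judge score $F(k,x)\in[0,1]$ (cheap, observed at every run, possibly biased). The judge bias may depend on arm and context: $\mathbb{E}[F(k,X)\mid X=x]=\mathbb{E}[Y(k,X)\mid X=x]+b_k(x)$, where $b_k(x)$ is an unknown bias function. Define $\theta_k=\mathbb{E}_{X\sim\mathcal{D}}[Y(k,X)]$ and let the best arm $k^\star\in\arg\max_{k\in[K]}\theta_k$ be any arm achieving the maximum. An instance is a specification of this model, and the model class is the collection of such instances. Interaction. In rounds $t=1,2,\dots$ the learner observes a context $X_t\sim\mathcal{D}$ and selects an arm $k_t\in[K]$; observes the judge score $F_t=F(k_t,X_t)$; and decides whether to audit, $A_t\in\{0,1\}$, where if $A_t=1$ it observes $Y_t=Y(k_t,X_t)$. The audit decision may depend on the history and on $(k_t,X_t,F_t)$, but not on the unobserved $Y_t$. The learner stops at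 a (random) time $\tau$ and outputs an arm $\widehat{k}$. Judge-only algorithms. An algorithm is judge-only if it never audits, i.e. $A_t\equiv0$, and its decision $\widehat{k}$ depends only on $\{(k_t,X_t,F_t)\}_{t\le\tau}$. *)

(* Defs.v *)
From HB Require Import structures.
From mathcomp Require Import all_boot all_order all_algebra.
From mathcomp Require Import all_classical all_reals all_analysis.

Set Implicit Arguments.
Unset Strict Implicit.
Unset Printing Implicit Defensive.

Import Order.TTheory GRing.Theory Num.Theory.
Local Open Scope classical_set_scope.
Local Open Scope ring_scope.

(* Y(k,x) and F(k,x) are the random variables [w |-> outcome k (x, w)] and
   [w |-> score k (x, w)] on a noise space whose law does not depend on x.
   So conditioning on X = x amounts to integrating over the noise with x
   fixed, and X and the noise together have law [ctx_law \x noise_law].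
   Y(k,x) and F(k,x) may be dependent, as may the variables of distinct arms. *)
Record instance (R : realType) (d : measure_display) (X : measurableType d)
    (K : nat) := Instance {
  ctx_law : probability X R ;
  noise_disp : measure_display ;
  noise : measurableType noise_disp ;
  noise_law : probability noise R ;
  outcome : 'I_K -> X * noise -> R ;
  score : 'I_K -> X * noise -> R ;
  bias : 'I_K -> X -> R ;
  measurable_outcome : forall k, measurable_fun setT (outcome k) ;
  measurable_score : forall k, measurable_fun setT (score k) ;
  outcome_bounded : forall k x,
    {ae noise_law, forall w, 0 <= outcome k (x, w) <= 1} ;
  score_bounded : forall k x,
    {ae noise_law, forall w, 0 <= score k (x, w) <= 1} ;
  biasE : forall k x,
    \int[noise_law]_w score k (x, w)
      = \int[noise_law]_w outcome k (x, w) + bias k x }.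

Section model.
Context {R : realType} {d : measure_display} {X : measurableType d} {K : nat}.
Implicit Type I : instance R X K.

Definition theta I (k : 'I_K) : R :=
  \int[(ctx_law I \x noise_law I)%E]_z outcome k z.

Definition best_arm I (k : 'I_K) : Prop := forall j, theta I j <= theta I k.

End model.

(* What the learner sees in a round: (k_t, X_t, F_t, A_t, Y_t), where the last
   entry is 0 when A_t = false. The arm is stored as a natural number, for which
   the library has the discrete sigma-algebra. *)
Notation observation R X := (nat * X * R * bool * R)%type.

(* Rounds are numbered from 0, and the t-tuple is the history of the first t
   rounds. The seed, drawn once before round 0, carries all the internal
   randomization of the learner. [stop] and [recommend] are consulted after t
   rounds, for every t (t = 0 included). *)
Record algorithm (R : realType) (d : measure_display) (X : measurableType d)
    (K : nat) := Algorithm {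
  seed_disp : measure_display ;
  seed : measurableType seed_disp ;
  seed_law : probability seed R ;
  select : forall t, seed * t.-tuple (observation R X) * X -> 'I_K ;
  audit : forall t, 'I_K ->
    seed * t.-tuple (observation R X) * X * R -> bool ;
  stop : forall t, seed * t.-tuple (observation R X) -> bool ;
  recommend : forall t, seed * t.-tuple (observation R X) -> 'I_K ;
  measurable_select : forall t,
    measurable_fun setT (fun p => nat_of_ord (select (t := t) p)) ;
  measurable_audit : forall t k, measurable_fun setT (audit (t := t) k) ;
  measurable_stop : forall t, measurable_fun setT (stop (t := t)) ;
  measurable_recommend : forall t,
    measurable_fun setT (fun p => nat_of_ord (recommend (t := t) p)) }.

Arguments select {R d X K} a t p.
Arguments audit {R d X K} a t k p.
Arguments stop {R d X K} a t p.
Arguments recommend {R d X K} a t p.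

Section interaction.
Context {R : realType} {d : measure_display} {X : measurableType d} {K : nat}.
Variables (I : instance R X K) (A : algorithm R X K).

(* If A never audits, the last two entries of every observation are constant,
   so all its decisions are functions of the (k_t, X_t, F_t) and of its internal
   randomization only. *)
Definition judge_only : Prop := forall t k p, audit A t k p = false.

Section trajectory.
Variables (s : seed A) (z : nat -> X * noise I).

Definition observe (t : nat) (h : t.-tuple (observation R X)) :
    observation R X :=
  let x := (z t).1 in
  let k := select A t (s, h, x) in
  let f := score k (z t) in
  let a := audit A t k (s, h, x, f) in
  (nat_of_ord k, x, f, a, if a then outcome k (z t) else 0).

Fixpoint history (t : nat) : t.-tuple (observation R X) :=
  match t with
  | 0 => [tuple]
  | t'.+1 => [tuple of rcons (history t') (observe (history t'))]
  end.

Definition stops (t : nat) : bool := stop A t (s, history t).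

(* [None] if the learner never stops. *)
Definition stopping_time : option nat :=
  if pselect (exists t, stops t) is left e then Some (ex_minn e) else None.

Definition khat : option 'I_K :=
  omap (fun t => recommend A t (s, history t)) stopping_time.

(* The observed data, as a sequence: entry t is (true, observation of round t)
   if round t takes place, and (false, _) with a fixed value otherwise. *)
Definition observed_data (t : nat) : bool * observation R X :=
  if [forall i : 'I_t.+1, ~~ stops i] then (true, observe (history t))
  else (false, (0%N, point, 0, false, 0)).

End trajectory.

(* A realization of the interaction on a probability space: the pairs
   (X_t, noise of round t) are i.i.d. and independent of the seed. *)
Record execution := Execution {
  omega_disp : measure_display ;
  omega : measurableType omega_disp ;
  prob : probability omega R ;
  seed_rv : omega -> seed A ;
  tape : omega -> nat -> X * noise I ;
  measurable_seed_rv : measurable_fun setT seed_rv ;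
  measurable_tape : forall t, measurable_fun setT (fun w => tape w t) ;
  joint_law : forall (n : nat) (B : set (seed A)) (C : 'I_n -> set (X * noise I)),
    measurable B -> (forall i, measurable (C i)) ->
    prob [set w | B (seed_rv w) /\ forall i, C i (tape w i)]
      = (seed_law A B
         * \prod_(i < n) (ctx_law I \x noise_law I) (C i))%E }.

Definition data (E : execution) (w : omega E) : nat -> bool * observation R X :=
  observed_data (seed_rv w) (tape w).

Definition output (E : execution) (w : omega E) : option 'I_K :=
  khat (seed_rv w) (tape w).

(* P(khat <> k); a learner that never stops outputs no arm, hence not k. *)
Definition error (E : execution) (k : 'I_K) : \bar R :=
  prob E [set w | output w <> Some k].

End interaction.

Arguments error {R d X K I A} E k.

Definition cylinders (d : measure_display) (T : measurableType d) :
    set (set (nat -> T)) :=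
  [set B | exists t (C : set T), measurable C /\ B = [set u | C (u t)]].

(* Equality of the laws of the observed data, as measures on the product
   sigma-algebra over the rounds. *)
Definition same_data_law (R : realType) (d : measure_display)
    (X : measurableType d) (K : nat) (A : algorithm R X K)
    (I I' : instance R X K) (E : execution I A) (E' : execution I' A) : Prop :=
  forall B : set (nat -> bool * observation R X),
    <<s @cylinders _ (bool * observation R X)%type >> B ->
    prob E (@data _ _ _ _ _ _ E @^-1` B) = prob E' (@data _ _ _ _ _ _ E' @^-1` B).

(* Main.v *)
Require Import Defs.
From mathcomp Require Import all_boot all_order all_algebra.
From mathcomp Require Import all_classical all_reals all_analysis.

(* Take two instances with the same context law and the same null judge score,
   in which arm g (resp. g') always has audit outcome 1 and every other arm 0.
   The bias absorbs the difference, so a judge-only learner follows the same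
   trajectory in both. The law of (seed, tape) is determined by its values on
   finite-dimensional boxes, a pi-system, so any two executions of one instance
   agree on every event of the trajectory. The error events for g and g' cover
   the whole space, so their probabilities cannot both be below 1/2. *)

Import Order.TTheory GRing.Theory Num.Theory.

Local Open Scope ring_scope.

(** * Measurability of finite case distinctions and of tuple extension *)

Section measurability.
Local Open Scope classical_set_scope.
Context {d : measure_display} {T : measurableType d}.

Lemma measurable_forall (J : finType) (f : J -> T -> bool) :
  (forall j, measurable_fun setT (f j)) ->
  measurable_fun setT (fun w => [forall j, f j w]).
Proof.
move=> mf; apply: (measurable_fun_bool true); rewrite setTI.
have -> : (fun w => [forall j, f j w]) @^-1` [set true]
    = \bigcap_(j in [set: J]) (f j @^-1` [set true]).
  by apply/seteqP; split=> w /= => [/forallP h j _|h]; [|apply/forallP => j];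
    exact: h.
apply: fin_bigcap_measurable; first exact: finite_finset.
by move=> j _; rewrite -[X in measurable X]setTI; exact: mf.
Qed.

Lemma measurable_fiber_nat (f : T -> nat) (n : nat) :
  measurable_fun setT f -> measurable_fun setT (fun w => f w == n).
Proof.
move=> mf; apply: (measurable_fun_bool true); rewrite setTI.
have -> : (fun w => f w == n) @^-1` [set true] = f @^-1` [set n].
  by apply/seteqP; split=> w /= /eqP.
by rewrite -[X in measurable X]setTI; exact: mf.
Qed.

(** There are finitely many indices, so the preimage is a finite union over [k] of the fiber of [c]
    at [k] cut with the preimage under [f k]. This serves to plug the selected arm into [score],
    [audit] and [outcome]. *)
Lemma measurable_select_fun {d' : measure_display} {U : measurableType d'}
    (K : nat) (c : T -> 'I_K) (f : 'I_K -> T -> U) :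
  measurable_fun setT (fun w => nat_of_ord (c w)) ->
  (forall k, measurable_fun setT (f k)) ->
  measurable_fun setT (fun w => f (c w) w).
Proof.
move=> mc mf _ B mB; rewrite setTI.
have -> : (fun w => f (c w) w) @^-1` B
    = \bigcup_(k in [set: 'I_K])
        ((fun w => c w == k :> nat) @^-1` [set true] `&` f k @^-1` B).
  apply/seteqP; split=> w /=; first by exists (c w); rewrite //= eqxx.
  by move=> [k _ [/= /eqP /val_inj <-]].
apply: fin_bigcup_measurable; first exact: finite_finset.
move=> k _; apply: measurableI; rewrite -[X in measurable X]setTI.
  exact: measurable_fiber_nat.
exact: mf.
Qed.

Lemma measurable_rcons {d' : measure_display} {U : measurableType d'} (n : nat)
    (h : T -> n.-tuple U) (f : T -> U) :
  measurable_fun setT h -> measurable_fun setT f ->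
  measurable_fun setT (fun w => [tuple of rcons (h w) (f w)]).
Proof.
move=> mh mf; apply/measurable_fun_tnthP => i.
(* Whether coordinate [i] is an old entry or the appended one does not depend on [w], so each
   coordinate is a single measurable function. *)
rewrite (_ : _ \o _ = fun w =>
    if insub (val i) is Some j then tnth (h w) j else f w); last first.
  apply/funext => w; rewrite /= (tnth_nth (f w)) /= nth_rcons size_tuple.
  case: insubP => [j lt_i eq_j | ge_i]; last by rewrite (negbTE ge_i) if_same.
  by rewrite -eq_j ltn_ord (tnth_nth (f w)).
case: insub => [j|//].
exact: measurableT_comp (measurable_tnth j) mh.
Qed.

End measurability.

(** * Measurability of the trajectory, for a seed and a tape defined on an arbitrary space [T] *)

Section trajectory_measurability.
Local Open Scope classical_set_scope.
Context {R : realType} {d : measure_display} {X : measurableType d} {K : nat}.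
Variables (I : instance R X K) (A : algorithm R X K).
Context {d' : measure_display} {T : measurableType d'}.
Variables (s : T -> seed A) (z : T -> nat -> X * noise I).
Hypotheses (ms : measurable_fun setT s)
  (mz : forall t, measurable_fun setT (fun w => z w t)).

Lemma measurable_observe t (h : T -> t.-tuple (observation R X)) :
  measurable_fun setT h ->
  measurable_fun setT (fun w => observe (s w) (z w) (h w)).
Proof.
move=> mh.
have mx : measurable_fun setT (fun w => (z w t).1).
  exact: measurableT_comp measurable_fst (mz t).
have mshx : measurable_fun setT (fun w => (s w, h w, (z w t).1)).
  by do 2 (apply: measurable_fun_pair => //).
pose c w := select A t (s w, h w, (z w t).1).
have mc : measurable_fun setT (fun w => nat_of_ord (c w)).
  exact: measurableT_comp (@measurable_select _ _ _ _ A t) mshx.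
have msc : measurable_fun setT (fun w => score (c w) (z w t)).
  apply: (@measurable_select_fun _ _ _ _ _ c
    (fun k w => score k (z w t))) => // k.
  exact: measurableT_comp (measurable_score k) (mz t).
pose a w := audit A t (c w) (s w, h w, (z w t).1, score (c w) (z w t)).
have ma : measurable_fun setT a.
  apply: (@measurable_select_fun _ _ _ _ _ c
    (fun k w => audit A t k (s w, h w, (z w t).1, score (c w) (z w t))))
    => // k.
  apply: (measurableT_comp (@measurable_audit _ _ _ _ A t k)).
  exact: measurable_fun_pair.
have my : measurable_fun setT
    (fun w => if a w then outcome (c w) (z w t) else 0 : R).
  apply: measurable_fun_ifT => //.
  apply: (@measurable_select_fun _ _ _ _ _ c
    (fun k w => outcome k (z w t))) => // k.
  exact: measurableT_comp (measurable_outcome k) (mz t).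
exact: (measurable_fun_pair (measurable_fun_pair (measurable_fun_pair
  (measurable_fun_pair mc mx) msc) ma) my).
Qed.

Lemma measurable_history t :
  measurable_fun setT (fun w => history (s w) (z w) t).
Proof.
elim: t => [|t IHt] /=; first exact: measurable_cst.
by apply: measurable_rcons => //; exact: measurable_observe.
Qed.

Lemma measurable_stops t : measurable_fun setT (fun w => stops (s w) (z w) t).
Proof.
apply: (measurableT_comp (@measurable_stop _ _ _ _ A t)).
by apply: measurable_fun_pair => //; exact: measurable_history.
Qed.

Lemma measurable_observed_data t :
  measurable_fun setT (fun w => observed_data (s w) (z w) t).
Proof.
apply: measurable_fun_ifT; last 2 first.
- by apply: measurable_fun_pair => //; apply: measurable_observe;
    exact: measurable_history.
- exact: measurable_cst.
apply: (@measurable_forall _ _ 'I_t.+1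
  (fun i w => ~~ stops (s w) (z w) i)) => i.
exact/measurable_neg/measurable_stops.
Qed.

(** This trades the minimum in [stopping_time] for a first-stop condition at an explicit [t], which
    turns the output event into a countable union of measurable conditions. *)
Lemma khatP (s0 : seed A) (z0 : nat -> X * noise I) (k : 'I_K) :
  khat s0 z0 = Some k <-> exists t, [&& [forall i : 'I_t, ~~ stops s0 z0 i],
    stops s0 z0 t & recommend A t (s0, history s0 z0 t) == k :> nat].
Proof.
rewrite /khat /stopping_time; case: pselect => [e|ne] /=; last first.
  by split=> // -[t /and3P[_ st _]]; case: ne; exists t.
case: ex_minnP => n stn minn;
  split=> [[<-]|[t /and3P[/forallP nst st /eqP rt]]].
  exists n; rewrite stn eqxx !andbT; apply/forallP => i.
  by apply/negP => /minn; rewrite leqNgt ltn_ord.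
suff -> : n = t by congr Some; exact: val_inj.
apply/eqP; rewrite eqn_leq minn //= leqNgt; apply/negP => lt_nt.
by have := nst (Ordinal lt_nt); rewrite stn.
Qed.

Lemma measurable_khat (k : 'I_K) :
  measurable [set w | khat (s w) (z w) <> Some k].
Proof.
(* Passing to the complement keeps the runs that never stop inside the error event. *)
rewrite (_ : [set w | _] = ~` \bigcup_t ((fun w =>
    [&& [forall i : 'I_t, ~~ stops (s w) (z w) i], stops (s w) (z w) t
      & recommend A t (s w, history (s w) (z w) t) == k :> nat])
    @^-1` [set true])); last first.
  apply/seteqP; split=> w /= nk.
    by move=> [t _ /= kt]; apply: nk; apply/khatP; exists t.
  by move=> /khatP[t kt]; apply: nk; exists t.
apply/measurableC/bigcup_measurable => t _; rewrite -[X in measurable X]setTI.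
have : measurable_fun setT (fun w =>
    [&& [forall i : 'I_t, ~~ stops (s w) (z w) i], stops (s w) (z w) t
      & recommend A t (s w, history (s w) (z w) t) == k :> nat]); last exact.
apply: measurable_and.
  apply: (@measurable_forall _ _ 'I_t (fun i w => ~~ stops (s w) (z w) i)) => i.
  exact/measurable_neg/measurable_stops.
apply: measurable_and; first exact: measurable_stops.
apply: (@measurable_fiber_nat _ _
  (fun w => nat_of_ord (recommend A t (s w, history (s w) (z w) t)))).
apply: (measurableT_comp (@measurable_recommend _ _ _ _ A t)).
by apply: measurable_fun_pair => //; exact: measurable_history.
Qed.

End trajectory_measurability.

(** * Uniqueness of the joint law of seed and tape *)

Section execution_law.
Local Open Scope classical_set_scope.
Context {R : realType} {d : measure_display} {X : measurableType d} {K : nat}.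
Variables (I : instance R X K) (A : algorithm R X K).

Let path := (seed A * (nat -> X * noise I))%type.

(** The sides [C] are indexed by all of [nat] and are full from [n] on, so that two boxes of
    different dimensions intersect side by side, with the larger of the two dimensions. *)
Definition boxes : set (set path) :=
  [set S | exists n (B : set (seed A)) (C : nat -> set (X * noise I)),
    [/\ measurable B, forall i, measurable (C i),
        forall i, (n <= i)%N -> C i = setT
      & S = [set p | B p.1 /\ forall i, C i (p.2 i)]]].

Let pathT := g_sigma_algebraType boxes.

Lemma setI_closed_boxes : setI_closed boxes.
Proof.
move=> _ _ [n1 [B1 [C1 [mB1 mC1 C1T ->]]]] [n2 [B2 [C2 [mB2 mC2 C2T ->]]]].
exists (maxn n1 n2), (B1 `&` B2), (fun i => C1 i `&` C2 i); split.
- exact: measurableI.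
- by move=> i; exact: measurableI.
- by move=> i; rewrite geq_max => /andP[? ?]; rewrite C1T // C2T // setTI.
- apply/seteqP; split=> p /=; first by move=> [[b1 c1] [b2 c2]].
  by move=> [[b1 b2] c]; split; split=> // i; have [] := c i.
Qed.

Lemma measurable_path_seed : measurable_fun setT (fst : pathT -> seed A).
Proof.
move=> _ B mB; rewrite setTI; apply: sub_sigma_algebra.
exists 0%N, B, (fun=> setT); split=> //.
by apply/seteqP; split=> [p|p []] /=.
Qed.

Lemma measurable_path_tape t : measurable_fun setT (fun p : pathT => p.2 t).
Proof.
move=> _ C mC; rewrite setTI; apply: sub_sigma_algebra.
(* Only coordinate [t] is constrained; the dimension is [t.+1] because sides must be full from the
   dimension on. *)
exists t.+1, setT, (fun i => if i == t then C else setT); split=> //.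
- by move=> i; case: ifP.
- by move=> i lt_ti; rewrite gtn_eqF.
- apply/seteqP; split=> p /=; last by move=> [_ /(_ t)]; rewrite eqxx.
  by move=> Cp; split=> // i; case: eqP => [->|].
Qed.

Definition path_of (E : execution I A) (w : omega E) : pathT :=
  (seed_rv w, tape w).

Lemma measurable_box_preimage (E : execution I A) S :
  boxes S -> measurable (@path_of E @^-1` S).
Proof.
move=> [n [B [C [mB mC _ ->]]]].
rewrite (_ : _ @^-1` _ = (@seed_rv _ _ _ _ _ _ E) @^-1` B
    `&` \bigcap_i ((fun w => tape w i) @^-1` C i)); last first.
  by apply/seteqP; split=> w /= [b c]; split=> // i; [move=> _|]; exact: c.
apply: measurableI.
  by rewrite -[X in measurable X]setTI; exact: measurable_seed_rv.
apply: bigcapT_measurable => i.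
by rewrite -[X in measurable X]setTI; exact: measurable_tape.
Qed.

Lemma measurable_path_of (E : execution I A) :
  measurable_fun setT (@path_of E).
Proof.
apply: (@measurability _ _ _ pathT setT (@path_of E) boxes) => //.
by move=> _ [S boxS <-]; rewrite setTI; exact: measurable_box_preimage.
Qed.

(** The executions may live on different sample spaces, so only the images of their probabilities
    under [path_of] are compared, by Dynkin induction from the boxes. *)
Lemma path_law_unique (E1 E2 : execution I A) (S : set pathT) :
  measurable S -> prob E1 (@path_of E1 @^-1` S) = prob E2 (@path_of E2 @^-1` S).
Proof.
have mpre (E : execution I A) (B : set pathT) :
    measurable B -> measurable (@path_of E @^-1` B).
  by move=> mB; rewrite -[X in measurable X]setTI; exact: measurable_path_of.
apply: (@dynkin_induction _ pathT boxes (fun S : set pathT =>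
  prob E1 (@path_of E1 @^-1` S) = prob E2 (@path_of E2 @^-1` S))) => //.
- exact: setI_closed_boxes.
- by rewrite !preimage_setT !probability_setT.
- move=> _ [n [B [C [mB mC CT ->]]]].
  (* The full sides are dropped in order to reach the finite form to which [joint_law] applies. *)
  have boxE (E : execution I A) :
      @path_of E @^-1` [set p | B p.1 /\ forall i, C i (p.2 i)]
      = [set w | B (seed_rv w) /\ forall i : 'I_n, C i (tape w i)].
    apply/seteqP; split=> w /= [b c]; split=> // i.
    by have [/CT ->//|lt_in] := leqP n i; exact: (c (Ordinal lt_in)).
  rewrite !boxE.
  have jointE E := joint_law E (C := fun i : 'I_n => C i) mB (fun i => mC i).
  by rewrite !jointE.
- move=> B mB eqB; rewrite -!preimage_setC.
  rewrite (probability_setC (prob E1) (mpre E1 B mB)).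
  by rewrite (probability_setC (prob E2) (mpre E2 B mB)) eqB.
- move=> F mF tF eqF; rewrite !preimage_bigcup.
  have tpre (E : execution I A) : trivIset setT (fun n => @path_of E @^-1` F n).
    apply/trivIsetP => i j _ _ ij; rewrite -preimage_setI.
    move/trivIsetP : tF => /(_ _ _ Logic.I Logic.I ij) ->.
    exact: preimage_set0.
  rewrite !measure_bigcup //; do ?[exact: tpre | by move=> i _; exact: mpre].
  by apply: eq_eseriesr => i _; exact: eqF.
Qed.

Lemma same_data_law_same_instance (E1 E2 : execution I A) : same_data_law E1 E2.
Proof.
move=> B sB.
pose D (p : pathT) := observed_data p.1 p.2.
apply: (path_law_unique E1 E2 (D @^-1` B)).
have mD t : measurable_fun setT (fun p : pathT => D p t).
  exact: (@measurable_observed_data _ _ _ _ I A _ pathT fst snd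
    measurable_path_seed measurable_path_tape).
(* Sets with measurable preimage under [D] form a sigma-algebra; as it contains the cylinders, it
   contains all that they generate. *)
have sD : sigma_algebra setT [set B | measurable (D @^-1` B)].
  split.
  - by rewrite /= preimage_set0.
  - by move=> C /= mC; rewrite setTD -preimage_setC; exact: measurableC.
  - move=> F mF; rewrite /= preimage_bigcup.
    by apply: bigcup_measurable => n _; exact: mF.
apply: (smallest_sub sD _ sB).
move=> _ [t [C [mC ->]]]; rewrite /= -[X in measurable X]setTI; exact: mD.
Qed.

Lemma error_same_instance (E1 E2 : execution I A) (k : 'I_K) :
  error E1 k = error E2 k.
Proof.
apply: (path_law_unique E1 E2 [set p : pathT | khat p.1 p.2 <> Some k]).
exact: (@measurable_khat _ _ _ _ I A _ pathT fst snd
  measurable_path_seed measurable_path_tape).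
Qed.

(** No output equals both [Some k] and [Some k'], so the two error events cover the space ([None]
    lies in both), and subadditivity applies. *)
Lemma error_add_ge1 (E : execution I A) (k k' : 'I_K) :
  k <> k' -> (1 <= error E k + error E k')%E.
Proof.
move=> kk'.
have mk j : measurable [set w | output (E := E) w <> Some j].
  exact: (@measurable_khat _ _ _ _ I A _ (omega E) (seed_rv (e := E))
    (tape (e := E)) (measurable_seed_rv (e := E)) (measurable_tape (e := E))).
rewrite -(@probability_setT _ _ _ (prob E)).
apply: le_trans (measureU2 _ (mk k) (mk k')).
apply: le_measure; rewrite ?inE //; first exact: measurableU.
move=> w _ /=; have [->|/eqP] := eqVneq (output w) (Some k); last by left.
by right=> -[].
Qed.

End execution_law.

(** * Deterministic instances with a single rewarding arm *)

Lemma Rintegral_cst_probability {R : realType} {d : measure_display}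
    {T : measurableType d} (P : probability T R) (r : R) : \int[P]_w r = r.
Proof.
transitivity (r * fine (P setT)); first exact: Rintegral_cst.
by rewrite probability_setT mulr1.
Qed.

Section one_good_arm.
Local Open Scope classical_set_scope.
Context {R : realType} {d : measure_display} {X : measurableType d} {K : nat}.

Let reward (g k : 'I_K) : R := (k == g)%:R.

Let noise_law : probability unit R := \d_tt.

Lemma reward_bounded (g k : 'I_K) (x : X) :
  {ae noise_law, forall w : unit, 0 <= reward g k <= 1}.
Proof. by apply/aeW => w; rewrite /reward ler0n lern1 leq_b1. Qed.

Lemma null_score_bounded (k : 'I_K) (x : X) :
  {ae noise_law, forall w : unit, 0 <= (0 : R) <= 1}.
Proof. by apply/aeW => w; rewrite lexx ler01. Qed.

Lemma null_score_bias (g k : 'I_K) (x : X) :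
  (\int[noise_law]_w (0 : R) = \int[noise_law]_w reward g k + - reward g k)%R.
Proof. by rewrite !Rintegral_cst_probability subrr. Qed.

(** Nothing is random: the context law is the Dirac mass at the default point of [X] and the noise
    space has one point. With a null score, [biasE] forces the bias to be [- reward g k]. *)
Definition one_good_arm (g : 'I_K) : instance R X K :=
  @Instance R d X K \d_point _ unit noise_law
    (fun k _ => reward g k) (fun _ _ => 0) (fun k _ => - reward g k)
    (fun k => measurable_cst _) (fun _ => measurable_cst _)
    (reward_bounded g) null_score_bounded (null_score_bias g).

Lemma theta_one_good_arm (g k : 'I_K) : theta (one_good_arm g) k = (k == g)%:R.
Proof.
exact: (Rintegral_cst_probability (ctx_law (one_good_arm g) \x noise_law)%E).
Qed.

Lemma best_arm_one_good_arm (g k : 'I_K) : best_arm (one_good_arm g) k -> k = g.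
Proof.
move=> /(_ g); rewrite !theta_one_good_arm eqxx.
by case: eqP => // _; rewrite ler10.
Qed.

End one_good_arm.

(** * Comparison of the two instances under a judge-only learner *)

Section indistinguishability.
Context {R : realType} {d : measure_display} {X : measurableType d} {K : nat}.
Variables (A : algorithm R X K) (hA : judge_only A) (g g' : 'I_K).
Let I := one_good_arm (R := R) (X := X) g.
Let I' := one_good_arm (R := R) (X := X) g'.

(* [I] and [I'] have the same context law and noise law, so an execution of [I']
   is, field by field, an execution of [I]. *)
Definition transfer (E : execution I' A) : execution I A :=
  @Execution R d X K I A _ _ (prob E) _ (fun w => tape w)
    (@measurable_seed_rv _ _ _ _ _ _ E) (@measurable_tape _ _ _ _ _ _ E)
    (@joint_law _ _ _ _ _ _ E).

(** [outcome] enters an observation only through the audited branch, which [hA] closes; the scores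
    are null in both instances. *)
Lemma observe_judge_only (s : seed A) (z : nat -> X * unit) t
    (h : t.-tuple (observation R X)) :
  observe (I := I) s z h = observe (I := I') s z h.
Proof. by rewrite /observe !hA. Qed.

Lemma history_judge_only (s : seed A) (z : nat -> X * unit) t :
  history (I := I) s z t = history (I := I') s z t.
Proof. by elim: t => //= t ->; rewrite observe_judge_only. Qed.

Lemma stops_judge_only (s : seed A) (z : nat -> X * unit) :
  stops (I := I) s z = stops (I := I') s z.
Proof. by apply/funext => t; rewrite /stops history_judge_only. Qed.

Lemma data_transfer (E : execution I' A) (w : omega E) :
  data (E := transfer E) w = data w.
Proof.
apply/funext => t; rewrite /data /observed_data stops_judge_only.
by rewrite history_judge_only observe_judge_only.
Qed.

Lemma output_transfer (E : execution I' A) (w : omega E) :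
  output (E := transfer E) w = output w.
Proof.
rewrite /output /khat /stopping_time stops_judge_only.
by case: pselect => //= e; rewrite history_judge_only.
Qed.

(** [E] and [transfer E'] are executions of the same instance, hence have the same data law, and the
    data of [transfer E'] agree pointwise with those of [E']. *)
Lemma same_data_law_judge_only (E : execution I A) (E' : execution I' A) :
  same_data_law E E'.
Proof.
move=> B sB; rewrite (same_data_law_same_instance _ _ E (transfer E') B sB).
by congr (prob E' _); apply/funext => w; rewrite /preimage /= data_transfer.
Qed.

Lemma error_transfer (E : execution I' A) (k : 'I_K) :
  error (transfer E) k = error E k.
Proof.
by congr (prob E _); apply/funext => w /=; rewrite output_transfer.
Qed.

End indistinguishability.

Theorem theorem3p3 (R : realType) (d : measure_display) (X : measurableType d)
    (K : nat) (hK : (1 < K)%N) (A : algorithm R X K) (hA : judge_only A) :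
  exists I I' : instance R X K,
    [/\ forall (E : execution I A) (E' : execution I' A), same_data_law E E',
        forall k k' : 'I_K, best_arm I k -> best_arm I' k' -> k <> k'
      & (forall (E : execution I A) (k : 'I_K),
            best_arm I k -> ((2^-1)%:E <= error E k)%E)
        \/ (forall (E' : execution I' A) (k' : 'I_K),
            best_arm I' k' -> ((2^-1)%:E <= error E' k')%E)].
Proof.
pose g : 'I_K := Ordinal (ltnW hK); pose g' : 'I_K := Ordinal hK.
have gg' : g <> g' by [].
exists (one_good_arm g), (one_good_arm g'); split.
- exact: same_data_law_judge_only.
- by move=> k k' /best_arm_one_good_arm -> /best_arm_one_good_arm ->.
(* Each alternative quantifies over all executions. If the first fails, one execution [E] with error
   at [g] below 1/2 is enough to settle the second for every [E']. *)
have [h|] := pselect (forall E : execution (one_good_arm g) A,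
    ((2^-1)%:E <= error E g)%E).
  by left=> E k /best_arm_one_good_arm ->.
move=> /existsNP[E /negP]; rewrite -ltNge => ltE.
right=> E' k' /best_arm_one_good_arm ->.
(* The error of [E'] at [g'] becomes that of [E] at [g'], so that both errors refer to [E], where
   their sum is at least 1. *)
rewrite -(error_transfer A hA g g' E') (error_same_instance _ _ _ E).
rewrite leNgt; apply/negP => ltE'.
have := error_add_ge1 _ _ E _ _ gg'; rewrite leNgt => /negP; apply.
rewrite (_ : 1%E = ((2^-1)%:E + (2^-1)%:E)%E); first exact: lteD.
by rewrite -EFinD -[X in X + _]mul1r -[X in _ + X]mul1r -splitr.
Qed.
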